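(* Let $Y$ be a real vector space, $F\subseteq Y$, $D\subseteq Y$ with $D\ne Y$, and assume $\varphi:F\to\mathbb{R}$. (a) $\operatorname{Eff}(F,D)\cap\operatorname{argmin}_F\varphi\subseteq\operatorname{Eff}(\operatorname{argmin}_F\varphi,D)$. (b) If $\varphi$ is $D$-monotone on $F$, then $\operatorname{Eff}(F,D)\cap\operatorname{argmin}_F\varphi=\operatorname{Eff}(\operatorname{argmin}_F\varphi,D)$. If, additionally, $\operatorname{argmin}_F\varphi=\{y^0\}$, then $y^0\in\operatorname{Eff}(F,D)$. (c) $\operatorname{argmin}_F\varphi\subseteq\operatorname{Eff}(F,D)$ holds if $\varphi$ is strictly $D$-monotone on $F$.
   Context: For $F,D\subseteq Y$, $\operatorname{Eff}(F,D):=\{y^0\in F\mid F\cap(y^0-D)\subseteq\{y^0\}\}$. $\operatorname{argmin}_F\varphi$ is the (possibly empty) set of minimizers of $\varphi$ on $F$. $\varphi$ is $D$-monotone on $F$ iff $y^1,y^2\in F$ and $y^2-y^1\in D$ imply $\varphi(y^1)\le\varphi(y^2)$; strictly $D$-monotone on $F$ iff $y^1,y^2\in F$ and $y^2-y^1\in D\setminus\{0\}$ imply $\varphi(y^1)<\varphi(y^2)$. *)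

(* Defs.v *)
From mathcomp Require Import all_boot all_order all_algebra.
From mathcomp Require Import classical_sets functions reals.
Set Implicit Arguments.
Unset Strict Implicit.
Unset Printing Implicit Defensive.
Import Order.TTheory GRing.Theory Num.Theory.
Local Open Scope classical_set_scope.
Local Open Scope ring_scope.

Section Efficiency.
Variables (R : realType) (Y : lmodType R).
Implicit Types F D : set Y.

Definition Eff F D : set Y :=
  [set y0 | F y0 /\ F `&` [set y0 - d | d in D] `<=` [set y0]].

(* A set F used as a type denotes the subtype of its elements (set_type), so
   that phi is defined on F only; set_val : F -> Y is the inclusion. *)
Definition argmin F (phi : F -> R) : set Y :=
  set_val @` [set x : F | forall z : F, phi x <= phi z].

Definition D_monotone F D (phi : F -> R) : Prop :=
  forall y1 y2 : F, D (set_val y2 - set_val y1) -> phi y1 <= phi y2.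

Definition strictly_D_monotone F D (phi : F -> R) : Prop :=
  forall y1 y2 : F, (D `\ 0) (set_val y2 - set_val y1) -> phi y1 < phi y2.

End Efficiency.

(* Main.v *)
Require Import Defs.
From mathcomp Require Import all_boot all_order all_algebra.
From mathcomp Require Import classical_sets functions reals.
Import Order.TTheory GRing.Theory Num.Theory.
Local Open Scope classical_set_scope.
Local Open Scope ring_scope.

(** Efficiency of [y0] in [F] says that no point [y] of [F] other than [y0]
    dominates it, i.e. satisfies [D (y0 - y)] ([EffP]).  Shrinking [F] removes
    competitors only, so an efficient point of [F] stays efficient in any subset
    that contains it ([Eff_subset]); this is (a).

    For the converse in (b), a point [y] of [F] dominating a minimizer [y0] has
    [phi y <= phi y0] by monotonicity and so is a minimizer itself
    ([argmin_dominated]): all competitors of [y0] in [F] lie in the argmin set,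
    where [y0] is efficient.  A singleton argmin set consists of a point that is
    trivially efficient in it.  For (c), strict monotonicity would give
    [phi y < phi y0], against the minimality of [y0]. *)

Lemma EffP (R : realType) (Y : lmodType R) (F D : set Y) (y0 : Y) :
  Eff F D y0 <-> F y0 /\ forall y, F y -> D (y0 - y) -> y = y0.
Proof.
split=> -[Fy0 eff]; split=> // y.
- by move=> Fy Dy; apply: eff; split=> //; exists (y0 - y); rewrite ?subKr.
- by move=> [Fy [d Dd yE]]; apply: eff => //; rewrite -yE subKr.
Qed.

Lemma Eff_subset (R : realType) (Y : lmodType R) (A F D : set Y) :
  A `<=` F -> Eff F D `&` A `<=` Eff A D.
Proof.
move=> AF y0 [/EffP[_ eff] Ay0]; apply/EffP; split=> // y /AF; exact: eff.
Qed.

Lemma Eff_set1 (R : realType) (Y : lmodType R) (D : set Y) (y0 : Y) :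
  Eff [set y0] D y0.
Proof. by apply/EffP. Qed.

Lemma argmin_sub (R : realType) (Y : lmodType R) (F : set Y) (phi : F -> R) :
  argmin phi `<=` F.
Proof. by move=> _ [x _ <-]; apply: set_valP. Qed.

(** Under monotonicity the argmin set absorbs the points dominating its
    elements, so efficiency inside it is as strong as efficiency in [F]. *)
Lemma argmin_dominated (R : realType) (Y : lmodType R) (F D : set Y)
    (phi : F -> R) (y0 y : Y) :
  D_monotone D phi -> argmin phi y0 -> F y -> D (y0 - y) -> argmin phi y.
Proof.
move=> mono [x xmin <-] Fy Dxy.
exists (SigSub (mem_set Fy)) => // z.
by apply: le_trans (xmin z); apply: mono.
Qed.

Lemma Eff_argmin_sub (R : realType) (Y : lmodType R) (F D : set Y)
    (phi : F -> R) :
  D_monotone D phi -> Eff (argmin phi) D `<=` Eff F D.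
Proof.
move=> mono y0 /EffP[min0 eff]; apply/EffP; split; first exact: argmin_sub min0.
by move=> y Fy Dy; apply: eff => //; apply: argmin_dominated Dy.
Qed.

Lemma argmin_sub_Eff (R : realType) (Y : lmodType R) (F D : set Y)
    (phi : F -> R) :
  strictly_D_monotone D phi -> argmin phi `<=` Eff F D.
Proof.
move=> smono _ [x xmin <-]; apply/EffP; split; first exact: set_valP.
move=> y Fy Dxy; apply/eqP/negPn/negP => /eqP yx.
suff: phi (SigSub (mem_set Fy)) < phi x by rewrite ltNge xmin.
by apply: smono; split=> //= /eqP; rewrite subr_eq0 => /eqP /esym.
Qed.

Theorem proposition17 (R : realType) (Y : lmodType R) (F D : set Y)
  (hD : D <> [set: Y]) (phi : F -> R) :
  (Eff F D `&` argmin phi `<=` Eff (argmin phi) D)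
  /\ (D_monotone D phi ->
        Eff F D `&` argmin phi = Eff (argmin phi) D
        /\ (forall y0 : Y, argmin phi = [set y0] -> Eff F D y0))
  /\ (strictly_D_monotone D phi -> argmin phi `<=` Eff F D).
Proof.
have sub : Eff F D `&` argmin phi `<=` Eff (argmin phi) D.
  by apply: Eff_subset; apply: argmin_sub.
split=> //; split; last exact: argmin_sub_Eff.
move=> mono; split.
- apply/seteqP; split=> // y0 eff.
  by split; [apply: Eff_argmin_sub eff | case: eff].
- move=> y0 min1; apply: (Eff_argmin_sub _ _ _ _ _ mono).
  by rewrite min1; apply: Eff_set1.
Qed.
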